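(* Let $M$ be a finite set endowed with two metrics $d_0$ and $d_1$, and let $r:M\to(0,\infty)$ be a function such that for all $x,y\in M$ $$|d_0(x,y)-d_1(x,y)|\le r(x)+r(y)\quad\text{and}\quad |r(x)-r(y)|\le d_0(x,y)+d_1(x,y).$$ Suppose that there exist a function $f:M\times M\to[0,\infty)$ and constants $C_1,C_2,C_3,C_4>0$ such that $c_1(M,d_1)\le C_1$, $c_1(M,\min\{f(x,y),r(x)+r(y)\})\le C_2$, and for all $x,y\in M$ $$\frac1{C_3}d_0(x,y)\le d_1(x,y)+f(x,y)\le C_4d_0(x,y).$$ Then the generalized twisted union $(M\times\mathbb{F}_2,d)$ of $(M,d_0)$ and $(M,d_1)$ with the joining function $r(\cdot)$ embeds into $L_1$ with distortion bounded above by a constant which depends only on $C_1,C_2,C_3$, and $C_4$.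
   Context: $\mathbb{F}_2=\{0,1\}$. $L_1$ stands for a space $L_1(\Omega,\Sigma,\mu)$, with its norm $\|\cdot\|$; embedding into $L_1$ means embedding into some such space. The distortion of a bilipschitz embedding $F$ of a metric space $X$ is $\mathrm{Lip}(F)\cdot\mathrm{Lip}(F^{-1}|_{F(X)})$, where $\mathrm{Lip}$ denotes the Lipschitz constant. Convention: for an arbitrary function $g:M\times M\to[0,\infty)$ (not necessarily a metric) and $K\ge1$, we write $c_1(M,g)\le K$ if there exists a map $\Psi:M\to L_1$ such that $g(x,y)\le\|\Psi(x)-\Psi(y)\|\le Kg(x,y)$ for all $x,y\in M$. Generalized twisted union: Let $M$ be a finite set endowed with two metrics $d_0,d_1$ and let $r:M\to(0,\infty)$ be a function such that $|d_0(x,y)-d_1(x,y)|\le r(x)+r(y)$ and $|r(x)-r(y)|\le d_0(x,y)+d_1(x,y)$ for all $x,y\in M$. The generalized twisted union of $(M,d_0)$ and $(M,d_1)$ with the joining function $r$ is the set $M\times\mathbb{F}_2$ with the metric $d$ defined as the shortest path metric of the weighted graph on $M\times\mathbb{F}_2$ with the following edges: for all $x,y\in M$, an edge between $(x,0)$ and $(y,0)$ of weight $d_0(x,y)$; for all $x,y\in M$, an edge between $(x,1)$ and $(y,1)$ of weight $d_1(x,y)$; for every $x\in M$, an edge between $(x,0)$ and $(x,1)$ of weight $r(x)$. *)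

(* Defs.v *)
From HB Require Import structures.
From mathcomp Require Import all_boot all_order all_algebra.
From mathcomp Require Import all_classical all_reals all_analysis.

Set Implicit Arguments.
Unset Strict Implicit.
Unset Printing Implicit Defensive.
Import Order.TTheory GRing.Theory Num.Theory.
Local Open Scope classical_set_scope.
Local Open Scope ring_scope.

Definition is_metric (R : realType) (T : Type) (d : T -> T -> R) : Prop :=
  [/\ forall x y, 0 <= d x y,
      forall x y, d x y = 0 <-> x = y,
      forall x y, d x y = d y x &
      forall x y z, d x z <= d x y + d y z].

(* [LspaceType1 mu] carries no normed structure in the library. The value of
   the norm does not depend on the representatives to which u and v coerce,
   and it is finite, so that [fine] loses nothing. *)
Definition distL1 (R : realType) (dsp : measure_display)
    (Omega : measurableType dsp) (mu : {measure set Omega -> \bar R})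
    (u v : LspaceType1 mu) : R :=
  fine ('N[mu]_1[EFin \o (fun w => (u w - v w)%R)])%E.

(* [g] is arbitrary, in particular it need not be a metric. *)
Definition c1_le (R : realType) (M : Type) (g : M -> M -> R) (K : R) : Prop :=
  exists (dsp : measure_display) (Omega : measurableType dsp)
         (mu : {measure set Omega -> \bar R}) (Psi : M -> LspaceType1 mu),
    forall x y, g x y <= distL1 (Psi x) (Psi y) <= K * g x y.

(* Equal to +oo when [f] is not Lipschitz. *)
Definition Lip (R : realType) (X Y : Type)
    (dX : X -> X -> R) (dY : Y -> Y -> R) (f : X -> Y) : \bar R :=
  ereal_inf [set K%:E | K in
    [set K : R | 0 <= K /\ forall x y, dY (f x) (f y) <= K * dX x y]].

Definition to_range (X Y : Type) (F : X -> Y) (x : X) : set_type (range F) :=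
  exist _ (F x) (mem_set (imageT F x)).

(* Finiteness of both Lipschitz constants is required separately because
   0 * +oo = 0 in [\bar R]. *)
Definition embeds_L1_with_distortion_le (R : realType) (X : Type)
    (dX : X -> X -> R) (D : R) : Prop :=
  exists (dsp : measure_display) (Omega : measurableType dsp)
         (mu : {measure set Omega -> \bar R}) (F : X -> LspaceType1 mu)
         (Finv : set_type (range F) -> X),
    let dF (u v : set_type (range F)) := distL1 (val u) (val v) in
    [/\ cancel (to_range F) Finv,
        cancel Finv (to_range F),
        (Lip dX (@distL1 R dsp Omega mu) F < +oo)%E,
        (Lip dF dX Finv < +oo)%E &
        (Lip dX (@distL1 R dsp Omega mu) F * Lip dF dX Finv <= D%:E)%E].

(* A weighted graph is given by [edge u v a]: there is an edge of weight [a]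
   from [u] to [v]. *)
Inductive walk (R : realType) (V : Type) (edge : V -> V -> R -> Prop) :
    V -> V -> R -> Prop :=
| walk_nil v : walk edge v v 0
| walk_step u v w a l :
    edge u v a -> walk edge v w l -> walk edge u w (a + l).

Definition shortest_path (R : realType) (V : Type)
    (edge : V -> V -> R -> Prop) (u v : V) : R :=
  inf [set l | walk edge u v l].

(* The edges are undirected: the first two families are symmetric because
   [d0] and [d1] are, the last one is listed in both directions. *)
Inductive twisted_union_edge (R : realType) (M : Type)
    (d0 d1 : M -> M -> R) (r : M -> R) :
    M * 'F_2 -> M * 'F_2 -> R -> Prop :=
| edge_side0 x y : twisted_union_edge d0 d1 r (x, 0) (y, 0) (d0 x y)
| edge_side1 x y : twisted_union_edge d0 d1 r (x, 1) (y, 1) (d1 x y)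
| edge_join01 x : twisted_union_edge d0 d1 r (x, 0) (x, 1) (r x)
| edge_join10 x : twisted_union_edge d0 d1 r (x, 1) (x, 0) (r x).

Definition twisted_union_dist (R : realType) (M : Type)
    (d0 d1 : M -> M -> R) (r : M -> R) : M * 'F_2 -> M * 'F_2 -> R :=
  shortest_path (twisted_union_edge d0 d1 r).

(* Main.v *)
(* Up to constants, d0 is d1 + min(f, r + r), because d0 <= d1 + r + r always
   holds, and d((x,0),(y,1)) is at most d1(x,y) + r(x).  Let Psi1 and Psi2
   realize d1 and min(f, r + r) in L_1, and let b minimize r on the finite set
   M.  Then
     F(x,0) = (Psi1 x, Psi2 x, r x)   and   F(x,1) = (Psi1 x, Psi2 b, 0)
   is the required embedding into a direct sum of L_1 spaces.  Its Lipschitz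
   bound only has to be checked on the edges; on the joining edges it holds
   since |Psi2 x - Psi2 b| <= C2 (r x + r b) <= 2 C2 r x by the choice of b. *)
From HB Require Import structures.
Require Import Defs.
From mathcomp Require Import all_boot all_order all_algebra.
From mathcomp Require Import all_classical all_reals all_analysis.
From mathcomp Require Import measurable_realfun lra.
Set Implicit Arguments.
Unset Strict Implicit.
Unset Printing Implicit Defensive.
Import Order.TTheory GRing.Theory Num.Theory.
Local Open Scope classical_set_scope.
Local Open Scope ring_scope.

(** * Disjoint unions of measure spaces *)

Section sum_measurable.
Context {d1 d2 : measure_display}.
Context {T1 : measurableType d1} {T2 : measurableType d2}.

(** This is the coproduct sigma-algebra, the largest one that makes both injections measurable. *)
Definition sum_measurable (A : set (T1 + T2)) : Prop :=
  measurable (inl @^-1` A) /\ measurable (inr @^-1` A).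

Let sum_measurable0 : sum_measurable set0.
Proof. by split; rewrite preimage_set0. Qed.

Let sum_measurableC A : sum_measurable A -> sum_measurable (~` A).
Proof. by move=> [? ?]; split; rewrite preimage_setC; exact: measurableC. Qed.

Let sum_measurable_bigcup (F : (set (T1 + T2))^nat) :
  (forall i, sum_measurable (F i)) -> sum_measurable (\bigcup_i F i).
Proof.
move=> mF; split; rewrite preimage_bigcup; apply: bigcup_measurable => i _.
- exact: (mF i).1.
- exact: (mF i).2.
Qed.

HB.instance Definition _ := isPointed.Build (T1 + T2)%type (inl point).
(** The display is only a tag, so the one of products serves for the pair [(d1, d2)]. *)
HB.instance Definition _ := @isMeasurable.Build
  (measure_prod_display (d1, d2)) (T1 + T2)%type sum_measurable
  sum_measurable0 sum_measurableC sum_measurable_bigcup.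

Lemma measurable_inl : measurable_fun setT (@inl T1 T2).
Proof. by move=> _ A [mA _]; rewrite setTI. Qed.

Lemma measurable_inr : measurable_fun setT (@inr T1 T2).
Proof. by move=> _ A [_ mA]; rewrite setTI. Qed.

Lemma measurable_fun_case_sum {d3} {T3 : measurableType d3}
    (f : T1 -> T3) (g : T2 -> T3) :
  measurable_fun setT f -> measurable_fun setT g ->
  measurable_fun setT (fun w => match w with inl a => f a | inr b => g b end).
Proof.
move=> mf mg _ A mA; rewrite setTI; split.
- by have := mf measurableT A mA; rewrite setTI.
- by have := mg measurableT A mA; rewrite setTI.
Qed.

Section sum_measure.
Context {R : realType}.
Variables (mu1 : {measure set T1 -> \bar R}) (mu2 : {measure set T2 -> \bar R}).

(* The disjoint union of two measure spaces carries the l_1-sum of their L_1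
   spaces. *)
Definition sum_measure : {measure set (T1 + T2) -> \bar R} :=
  measure_add
    (measure_function_pushforward__canonical__measure_function_Measure
      mu1 measurable_inl)
    (measure_function_pushforward__canonical__measure_function_Measure
      mu2 measurable_inr).

Lemma ge0_integral_sum_measure (f : T1 + T2 -> \bar R) :
  (forall w, 0 <= f w)%E -> measurable_fun setT f ->
  (\int[sum_measure]_w f w =
   \int[mu1]_a f (inl a) + \int[mu2]_b f (inr b))%E.
Proof.
move=> f0 mf.
rewrite (ge0_integral_measure_add _ _ measurableT (fun w _ => f0 w) mf).
congr (_ + _)%E.
- exact: (ge0_integral_pushforward measurable_inl mu1 measurableT mf
    (fun w _ => f0 w)).
- exact: (ge0_integral_pushforward measurable_inr mu2 measurableT mf
    (fun w _ => f0 w)).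
Qed.
End sum_measure.
End sum_measurable.

(** * Functions of two points that are pulled back from an L_1 distance *)

Section L1_embeddable.
Context {R : realType}.

Lemma distL1E {d} {Omega : measurableType d}
    {mu : {measure set Omega -> \bar R}} (u v : LspaceType1 mu) :
  distL1 u v = fine (\int[mu]_w `|(u w - v w)%:E|)%E.
Proof. by rewrite /distL1 Lnorm1. Qed.

Lemma Lspace1_measurable {d} {Omega : measurableType d}
    {mu : {measure set Omega -> \bar R}} (u : LspaceType1 mu) :
  measurable_fun setT (u : Omega -> R).
Proof.
pose v : {mfun_ mu, Omega >-> measurableTypeR R} := u.
exact: (measurable_funP (repr v)).
Qed.

Lemma Lspace1_integrable {d} {Omega : measurableType d}
    {mu : {measure set Omega -> \bar R}} (u : LspaceType1 mu) :
  mu.-integrable setT (fun w => (u w)%:E).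
Proof.
apply/integrableP; split.
  exact/measurable_EFinP/Lspace1_measurable.
by have := @Lebesgue_finite _ _ _ _ _ _ u; rewrite /finite_norm Lnorm1.
Qed.

(** The coercion of [u] to a function picks a representative of its class, so [f] is recovered only
    almost everywhere. *)
Lemma Lspace1_of_integrable {d} {Omega : measurableType d}
    {mu : {measure set Omega -> \bar R}} (f : Omega -> R) :
  mu.-integrable setT (fun w => (f w)%:E) ->
  exists u : LspaceType1 mu, (u : Omega -> R) = f %[ae mu].
Proof.
move=> intf.
have mf : measurable_fun setT f.
  exact/measurable_EFinP/(measurable_int _ intf).
pose mixf := isMeasurableFun.Build _ _ Omega (measurableTypeR R) f mf.
pose mfunf : {mfun Omega >-> measurableTypeR R} := HB.pack f mixf.
pose v : {mfun_ mu, Omega >-> measurableTypeR R} :=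
  \pi_({mfun_ mu, Omega >-> measurableTypeR R})%qT mfunf.
have vf : (v : Omega -> R) = f %[ae mu].
  (* Equality of classes in the quotient unfolds to almost everywhere equality of
     representatives. *)
  have : v == \pi_({mfun_ mu, Omega >-> measurableTypeR R})%qT mfunf by [].
  rewrite -[v in v == _]reprK eqmodE => /asboolP; exact.
have finv : finite_norm mu 1 (v : Omega -> R).
  have mv : measurable_fun setT (v : Omega -> R).
    exact: (measurable_funP (repr v)).
  rewrite /finite_norm Lnorm1.
  rewrite (ae_eq_integral (fun w => `|(f w)%:E|)%E)//.
  - by have /integrableP[] := intf.
  - by apply: measurableT_comp => //; exact/measurable_EFinP.
  - by apply: measurableT_comp => //; exact/measurable_EFinP.
  - by apply: filterS vf => w /= + _ => ->.
pose mixv := isFinLebesgue.Build _ _ _ _ _ (@lexx _ _ 1%E) v finv.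
pose w : LspaceType1 mu := HB.pack v mixv.
by exists w.
Qed.
(** Keeping only the pulled-back distance turns direct sums of maps into sums of functions. Here [g]
    may vanish off the diagonal. *)
Definition L1_embeddable {X : Type} (g : X -> X -> R) : Prop :=
  exists (d : measure_display) (Omega : measurableType d)
         (mu : {measure set Omega -> \bar R}) (F : X -> LspaceType1 mu),
    forall x y, distL1 (F x) (F y) = g x y.

Lemma integrable_distL1 {d} {Omega : measurableType d}
    {mu : {measure set Omega -> \bar R}} (u v : Omega -> R) :
  mu.-integrable setT (fun w => (u w)%:E) ->
  mu.-integrable setT (fun w => (v w)%:E) ->
  mu.-integrable setT (fun w => `|(u w - v w)%:E|)%E.
Proof.
move=> iu iv; apply/integrable_abse.
under eq_fun do rewrite EFinB.
exact: integrableB.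
Qed.

(** Maps into L_1 can thus be given by actual functions: passing to classes changes the integrand
    only on a null set. *)
Lemma L1_embeddable_integrable {d} {Omega : measurableType d}
    (mu : {measure set Omega -> \bar R}) {X : Type} (f : X -> Omega -> R) :
  (forall x, mu.-integrable setT (fun w => (f x w)%:E)) ->
  L1_embeddable (fun x y => fine (\int[mu]_w `|(f x w - f y w)%:E|)%E).
Proof.
move=> intf.
have [F Ff] := choice (fun x => Lspace1_of_integrable (intf x)).
exists d, Omega, mu, F => x y; rewrite distL1E; congr fine.
apply: ae_eq_integral => //.
- exact: measurable_int
    (integrable_distL1 (Lspace1_integrable _) (Lspace1_integrable _)).
- exact: measurable_int (integrable_distL1 (intf x) (intf y)).
- by apply: filterS2 (Ff x) (Ff y) => w /(_ I) + /(_ I) + _ => -> ->.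
Qed.

Lemma L1_embeddable_comp {X Y : Type} (h : Y -> X) (g : X -> X -> R) :
  L1_embeddable g -> L1_embeddable (fun x y => g (h x) (h y)).
Proof.
move=> [dsp [Om [mu [F FE]]]].
by exists dsp, Om, mu, (F \o h) => x y; rewrite /= FE.
Qed.

(** The real line is the L_1 space of a single atom of mass one. *)
Lemma L1_embeddable_norm {X : Type} (h : X -> R) :
  L1_embeddable (fun x y => `|h x - h y|).
Proof.
have int x : (dirac tt : {measure set unit -> \bar R}).-integrable setT
    (fun=> (h x)%:E).
  by apply: finite_measure_integrable_cst.
have [dsp [Om [mu [F FE]]]] := L1_embeddable_integrable int.
exists dsp, Om, mu, F => x y; rewrite FE integral_dirac//.
by rewrite diracE in_setT mul1e.
Qed.

(** The two maps are glued to one function on the disjoint union of the measure spaces, over which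
    the integral splits. *)
Lemma L1_embeddableD {X : Type} (g1 g2 : X -> X -> R) :
  L1_embeddable g1 -> L1_embeddable g2 ->
  L1_embeddable (fun x y => g1 x y + g2 x y).
Proof.
move=> [d1 [Om1 [mu1 [F1 F1g]]]] [d2 [Om2 [mu2 [F2 F2g]]]].
pose f x (w : Om1 + Om2) : R :=
  match w with inl a => F1 x a | inr b => F2 x b end.
have mf x : measurable_fun setT (f x).
  by apply: measurable_fun_case_sum; exact: Lspace1_measurable.
have intf x : (sum_measure mu1 mu2).-integrable setT (fun w => (f x w)%:E).
  apply/integrableP; split; first exact/measurable_EFinP.
  rewrite ge0_integral_sum_measure//.
    have /integrableP[_ i1] := Lspace1_integrable (F1 x).
    have /integrableP[_ i2] := Lspace1_integrable (F2 x).
    exact: lte_add_pinfty.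
  by apply: measurableT_comp => //; exact/measurable_EFinP.
have [dsp [Om [mu [F FE]]]] := L1_embeddable_integrable intf.
exists dsp, Om, mu, F => x y; rewrite FE ge0_integral_sum_measure//; last first.
  exact: measurable_int (integrable_distL1 (intf x) (intf y)).
rewrite fineD -?F1g -?F2g ?distL1E//; apply: integrable_fin_num => //;
  apply: integrable_distL1; exact: Lspace1_integrable.
Qed.

Lemma L1_embeddable_ge0 {X : Type} (g : X -> X -> R) :
  L1_embeddable g -> forall x y, 0 <= g x y.
Proof.
move=> [dsp [Om [mu [F FE]]]] x y.
by rewrite -FE distL1E fine_ge0// integral_ge0.
Qed.

Lemma L1_embeddable_refl {X : Type} (g : X -> X -> R) :
  L1_embeddable g -> forall x, g x x = 0.
Proof.
move=> [dsp [Om [mu [F FE]]]] x; rewrite -FE distL1E.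
by under eq_integral do rewrite subrr abse0; rewrite integral0.
Qed.

Lemma L1_embeddable_sym {X : Type} (g : X -> X -> R) :
  L1_embeddable g -> forall x y, g x y = g y x.
Proof.
move=> [dsp [Om [mu [F FE]]]] x y; rewrite -!FE !distL1E.
by under eq_integral do rewrite abse_EFin distrC.
Qed.

Lemma L1_embeddable_triangle {X : Type} (g : X -> X -> R) :
  L1_embeddable g -> forall x y z, g x z <= g x y + g y z.
Proof.
move=> [dsp [Om [mu [F FE]]]] x y z; rewrite -!FE !distL1E.
have int u v :=
  integrable_distL1 (Lspace1_integrable (F u)) (Lspace1_integrable (F v)).
have fin u v : (\int[mu]_w `|(F u w - F v w)%:E|)%E \is a fin_num.
  exact: integrable_fin_num.
rewrite -fineD//; apply: fine_le; [exact: fin| |].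
  by rewrite fin_numD; apply/andP; split; exact: fin.
rewrite -(integralD measurableT (int x y) (int y z)).
apply: ge0_le_integral => //.
- exact: measurable_int (int x z).
- apply: emeasurable_funD; [exact: measurable_int (int x y)|].
  exact: measurable_int (int y z).
by move=> w _; rewrite !abse_EFin -EFinD lee_fin ler_distD.
Qed.

(** The map is exchanged for its pulled-back distance [g'], so that later estimates compare real
    functions only. *)
Lemma L1_embeddable_c1_le {X : Type} (g : X -> X -> R) (K : R) :
  c1_le g K ->
  exists2 g', L1_embeddable g' & forall x y, g x y <= g' x y <= K * g x y.
Proof.
move=> [dsp [Om [mu [F FE]]]].
by exists (fun x y => distL1 (F x) (F y)) => //; exists dsp, Om, mu, F.
Qed.

Lemma Lip_le {X Y : Type} (dX : X -> X -> R) (dY : Y -> Y -> R) f (K : R) :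
  0 <= K -> (forall x y, dY (f x) (f y) <= K * dX x y) ->
  (Lip dX dY f <= K%:E)%E.
Proof. by move=> K0 fK; apply: ereal_inf_lbound; exists K. Qed.

Lemma Lip_ge0 {X Y : Type} (dX : X -> X -> R) (dY : Y -> Y -> R) f :
  (0 <= Lip dX dY f)%E.
Proof. by apply: le_ereal_inf_tmp => _ [K [K0 _]] <-; rewrite lee_fin. Qed.

(** Since [g] vanishes only on the diagonal, the map realizing it is injective and has an inverse on
    its range; [B] and [A] bound the two Lipschitz constants. *)
Lemma L1_embeddable_distortion {X : Type} (dX g : X -> X -> R) (A B : R) :
  L1_embeddable g -> 0 <= A -> 0 <= B ->
  (forall x y, g x y = 0 -> x = y) ->
  (forall x y, dX x y <= A * g x y) ->
  (forall x y, g x y <= B * dX x y) ->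
  embeds_L1_with_distortion_le dX (B * A).
Proof.
move=> gL A0 B0 g_inj dA gB.
have g_refl := L1_embeddable_refl gL.
move: gL => [dsp [Om [mu [F FE]]]].
have F_inj : injective F.
  by move=> x y Fxy; apply: g_inj; rewrite -FE Fxy FE g_refl.
have /choice[Finv FinvK] :
    forall u : set_type (range F), exists x, F x = val u.
  by move=> u; have [x _ <-] := set_mem (valP u); exists x.
exists dsp, Om, mu, F, Finv => dF.
have LipF : (Lip dX (@distL1 R dsp Om mu) F <= B%:E)%E.
  by apply: Lip_le => // x y; rewrite FE.
have LipFinv : (Lip dF dX Finv <= A%:E)%E.
  by apply: Lip_le => // u v; rewrite /dF -!FinvK FE; exact: dA.
split.
- by move=> x; apply: F_inj; rewrite FinvK.
- by move=> u; apply: val_inj; rewrite /= FinvK.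
- exact: le_lt_trans LipF (ltry _).
- exact: le_lt_trans LipFinv (ltry _).
- by rewrite EFinM; apply: lee_pmul => //; exact: Lip_ge0.
Qed.
End L1_embeddable.

(** * Bounds on shortest path distances *)

Section shortest_path.
Context {R : realType} {V : Type} {edge : V -> V -> R -> Prop}.

(** Nonnegative weights bound the walk lengths from below, which makes the infimum a lower bound of
    them. *)
Lemma shortest_path_le u v l :
  (forall u v a, edge u v a -> 0 <= a) ->
  walk edge u v l -> shortest_path edge u v <= l.
Proof.
move=> edge_ge0 uvl; apply: ge_inf => //.
exists 0 => m; elim=> // {u v l uvl m} u v w a l uva _ l0.
by rewrite addr_ge0// (edge_ge0 _ _ _ uva).
Qed.

(** Induction along a walk, with the triangle inequality, reduces the bound to edges. A walk must
    exist because the infimum of the empty set is 0 by default. *)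
Lemma le_shortest_path (g : V -> V -> R) (B : R) u v :
  0 < B -> (exists l, walk edge u v l) ->
  (forall u, g u u = 0) -> (forall u v w, g u w <= g u v + g v w) ->
  (forall u v a, edge u v a -> g u v <= B * a) ->
  g u v <= B * shortest_path edge u v.
Proof.
move=> B0 uv g_refl g_triangle gB; rewrite mulrC -ler_pdivrMr//.
apply: lb_le_inf => // m; elim=> [w|{}u {uv}v w a l uva _].
  by rewrite g_refl mul0r.
rewrite !ler_pdivrMr// => gvw; rewrite mulrDl.
by apply: le_trans (g_triangle u v w) _; rewrite lerD// mulrC; exact: gB.
Qed.
End shortest_path.

(** * Short walks in the twisted union *)

Lemma F2_eq0or1 (i : 'F_2) : i = 0 \/ i = 1.
Proof.
by case: i => [[|[|]]]// i2; [left|right]; exact: val_inj.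
Qed.

Section twisted_union.
Context {R : realType} {M : Type} {d0 d1 : M -> M -> R} {r : M -> R}.
Hypotheses (d0_ge0 : forall x y, 0 <= d0 x y)
  (d1_ge0 : forall x y, 0 <= d1 x y).
Hypothesis r_ge0 : forall x, 0 <= r x.

Let edge_ge0 u v a : twisted_union_edge d0 d1 r u v a -> 0 <= a.
Proof. by case. Qed.

Let walk1 u v a : twisted_union_edge d0 d1 r u v a ->
  walk (twisted_union_edge d0 d1 r) u v a.
Proof. by move=> e; rewrite -[a]addr0; apply: walk_step e (walk_nil _ _). Qed.

Lemma twisted_union_dist00 x y :
  twisted_union_dist d0 d1 r (x, 0) (y, 0) <= d0 x y.
Proof. exact/shortest_path_le/walk1/edge_side0. Qed.

Lemma twisted_union_dist11 x y :
  twisted_union_dist d0 d1 r (x, 1) (y, 1) <= d1 x y.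
Proof. exact/shortest_path_le/walk1/edge_side1. Qed.

Let walk01 x y :
  walk (twisted_union_edge d0 d1 r) (x, 0) (y, 1) (r x + d1 x y).
Proof. exact/(walk_step (edge_join01 _ _ _ _))/walk1/edge_side1. Qed.

Let walk10 x y :
  walk (twisted_union_edge d0 d1 r) (x, 1) (y, 0) (d1 x y + r y).
Proof. exact/(walk_step (edge_side1 _ _ _ _ _))/walk1/edge_join10. Qed.

Lemma twisted_union_dist01 x y :
  twisted_union_dist d0 d1 r (x, 0) (y, 1) <= r x + d1 x y.
Proof. exact/shortest_path_le/walk01. Qed.

Lemma twisted_union_dist10 x y :
  twisted_union_dist d0 d1 r (x, 1) (y, 0) <= d1 x y + r y.
Proof. exact/shortest_path_le/walk10. Qed.

Lemma twisted_union_connected u v :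
  exists l, walk (twisted_union_edge d0 d1 r) u v l.
Proof.
case: u v => [x i] [y j]; have [->|->] := F2_eq0or1 i;
  have [->|->] := F2_eq0or1 j; eexists.
- exact/walk1/edge_side0.
- exact: walk01.
- exact: walk10.
- exact/walk1/edge_side1.
Qed.
End twisted_union.

(** * The embedding of the twisted union and its distortion *)

Lemma exists_argmin {R : realType} {M : finType} (r : M -> R) :
  exists b : M -> M, forall x y, b x = b y /\ r (b x) <= r x.
Proof.
(* An empty [M] has no minimizer, which is why [b] is a constant map and not a point. *)
case: (pickP (@predT M)) => [m _|M0]; last first.
  by exists id => x; have := M0 x.
exists (fun=> [arg min_(i < m) r i]%O) => x _; split=> //.
by case: arg_minP => [//|i _ imin]; exact: imin.
Qed.

Theorem theorem5p2 (R : realType) (C1 C2 C3 C4 : R) :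
  0 < C1 -> 0 < C2 -> 0 < C3 -> 0 < C4 ->
  exists D : R,
    forall (M : finType) (d0 d1 : M -> M -> R) (r : M -> R)
           (f : M -> M -> R),
      is_metric d0 -> is_metric d1 ->
      (forall x, 0 < r x) ->
      (forall x y, `|d0 x y - d1 x y| <= r x + r y) ->
      (forall x y, `|r x - r y| <= d0 x y + d1 x y) ->
      (forall x y, 0 <= f x y) ->
      c1_le d1 C1 ->
      c1_le (fun x y => Num.min (f x y) (r x + r y)) C2 ->
      (forall x y, C3^-1 * d0 x y <= d1 x y + f x y <= C4 * d0 x y) ->
      embeds_L1_with_distortion_le (twisted_union_dist d0 d1 r) D.
Proof.
move=> C1_gt0 C2_gt0 C3_gt0 C4_gt0.
(* [A] adds the factors from the two cases of the minimum. [B] dominates the edge constants: [C1] on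
   side 1, [2 * C2 + 1] on joining edges, [1 + (C1 + C2 + 1) * C4] on side 0. *)
pose A := C3 + 1; pose B := C1 + 2 * C2 + 1 + (C1 + C2 + 1) * C4.
exists (B * A) => M d0 d1 r f [d0_ge0 d0_eq0 _ _] [d1_ge0 d1_eq0 _ _].
move=> r_gt0 d01_le r_le f_ge0 /L1_embeddable_c1_le[g1 g1L g1E].
move=> /L1_embeddable_c1_le[g2 g2L g2E] d0E.
have [b bE] := exists_argmin r.
(* [p] gives the point at which the second map is evaluated and [h] the real coordinate; [g] is the
   resulting pulled-back distance. *)
pose p (u : M * 'F_2) := if u.2 == 0 then u.1 else b u.1.
pose h (u : M * 'F_2) := if u.2 == 0 then r u.1 else 0.
pose g u v := g1 u.1 v.1 + g2 (p u) (p v) + `|h u - h v|.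
have gL : L1_embeddable g.
  apply: L1_embeddableD; last exact: L1_embeddable_norm.
  by apply: L1_embeddableD; exact: L1_embeddable_comp.
have g2_ge0 := L1_embeddable_ge0 g2L.
have g00 x y : d0 x y <= A * g (x, 0) (y, 0).
  have d0f : d0 x y <= C3 * (d1 x y + f x y).
    by rewrite mulrC -ler_pdivrMr// mulrC; case/andP: (d0E x y).
  have d0r : d0 x y <= d1 x y + (r x + r y).
    by have := d01_le x y; rewrite ler_norml => /andP[_]; lra.
  have gmin : d1 x y + Num.min (f x y) (r x + r y) <= g (x, 0) (y, 0).
    have /andP[+ _] := g2E x y; have /andP[+ _] := g1E x y.
    by rewrite /g /p /h /=; have := normr_ge0 (r x - r y); lra.
  have g_ge0 := L1_embeddable_ge0 gL (x, 0) (y, 0).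
  (* If the minimum is [f], then [d0f] costs a factor [C3]; if it is [r x + r y], then [d0r] gives
     the bound with factor 1. *)
  move: gmin; rewrite /A mulrDl mul1r; case: (leP (f x y)) => _ gmin.
    have : C3 * (d1 x y + f x y) <= C3 * g (x, 0) (y, 0) by rewrite ler_pM2l.
    by lra.
  have : 0 <= C3 * g (x, 0) (y, 0) by rewrite mulr_ge0// ltW.
  by lra.
have r_ge0 x : 0 <= r x by exact: ltW.
have g01 x y : r x + d1 x y <= g (x, 0) (y, 1).
  rewrite /g /p /h /= subr0 ger0_norm//.
  by have /andP[+ _] := g1E x y; have := g2_ge0 x (b y); lra.
have g10 x y : d1 x y + r y <= g (x, 1) (y, 0).
  rewrite /g /p /h /= sub0r normrN ger0_norm//.
  by have /andP[+ _] := g1E x y; have := g2_ge0 (b x) y; lra.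
have g11 x y : d1 x y <= g (x, 1) (y, 1).
  rewrite /g /p /h /= subrr normr0.
  by have /andP[+ _] := g1E x y; have := g2_ge0 (b x) (b y); lra.
have g_le u v : g u v <= A * g u v.
  have := L1_embeddable_ge0 gL u v; rewrite /A; nra.
apply: (L1_embeddable_distortion gL).
- by rewrite /A; lra.
- by rewrite /B; nra.
(* Points on different sides are separated because [g] is there at least a value of [r], which is
   positive. *)
- move=> [x i] [y j]; have [->|->] := F2_eq0or1 i;
    have [->|->] := F2_eq0or1 j => g0.
  + have := g00 x y; rewrite g0 mulr0 => d0_le0.
    by congr pair; apply/d0_eq0/le_anti; rewrite d0_le0 d0_ge0.
  + by exfalso; have := g01 x y; have := r_gt0 x; have := d1_ge0 x y; lra.
  + by exfalso; have := g10 x y; have := r_gt0 y; have := d1_ge0 x y; lra.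
  + have := g11 x y; rewrite g0 => d1_le0.
    by congr pair; apply/d1_eq0/le_anti; rewrite d1_le0 d1_ge0.
- move=> [x i] [y j]; have [->|->] := F2_eq0or1 i;
    have [->|->] := F2_eq0or1 j.
  + exact: le_trans (twisted_union_dist00 d0_ge0 d1_ge0 r_ge0 x y) (g00 x y).
  + apply: le_trans (twisted_union_dist01 d0_ge0 d1_ge0 r_ge0 x y) _.
    exact: le_trans (g01 x y) (g_le _ _).
  + apply: le_trans (twisted_union_dist10 d0_ge0 d1_ge0 r_ge0 x y) _.
    exact: le_trans (g10 x y) (g_le _ _).
  + apply: le_trans (twisted_union_dist11 d0_ge0 d1_ge0 r_ge0 x y) _.
    exact: le_trans (g11 x y) (g_le _ _).
- move=> u v; apply: le_shortest_path.
  + by rewrite /B; nra.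
  + exact: twisted_union_connected.
  + exact: L1_embeddable_refl.
  + exact: L1_embeddable_triangle.
  + have gjoin x : g (x, 0) (x, 1) <= B * r x.
      rewrite /g /p /h /= (L1_embeddable_refl g1L) subr0 ger0_norm//.
      have /andP[_] := g2E x (b x).
      have : C2 * Num.min (f x (b x)) (r x + r (b x)) <= C2 * (2 * r x).
        rewrite ler_pM2l// ge_min; apply/orP; right.
        by have [_] := bE x x; lra.
      (* These are the summands of [B] that this edge does not use up; their sign makes the goal
         linear. *)
      have : 0 <= (C1 + (C1 + C2 + 1) * C4) * r x.
        by apply: mulr_ge0 => //; nra.
      by rewrite /B; lra.
    move=> {u v} u v a; case=> [x y|x y|x|x].
    (* On side 0 both [d1] and [f] are at most [C4 * d0], and [r_le] bounds the last coordinate by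
       [d0 + d1], hence by [(1 + C4) * d0]. *)
    * rewrite /g /p /h /=.
      have /andP[_ d1f] := d0E x y.
      have d1_le : d1 x y <= C4 * d0 x y by have := f_ge0 x y; lra.
      have g1_le : g1 x y <= C1 * (C4 * d0 x y).
        have /andP[_ /le_trans] := g1E x y; apply.
        by rewrite ler_pM2l.
      have g2_le : g2 x y <= C2 * (C4 * d0 x y).
        have /andP[_ /le_trans] := g2E x y; apply.
        rewrite ler_pM2l// ge_min; apply/orP; left.
        by have := d1_ge0 x y; lra.
      have : 0 <= (C1 + 2 * C2) * d0 x y by apply: mulr_ge0 => //; lra.
      by have := r_le x y; rewrite /B; lra.
    (* On side 1 the map [b] is constant and [h] is zero, so only [g1] remains. *)
    * rewrite /g /p /h /= (bE x y).1 (L1_embeddable_refl g2L) subrr normr0.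
      have /andP[_] := g1E x y.
      have : 0 <= (2 * C2 + 1 + (C1 + C2 + 1) * C4) * d1 x y.
        by apply: mulr_ge0 => //; nra.
      by rewrite /B; lra.
    * exact: gjoin.
    * by rewrite (L1_embeddable_sym gL); exact: gjoin.
Qed.
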